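(* Let $(d_k,d_{k-1},\ldots,d_0)_b$ be a 1089 $(n,b)$-palintiple. Then for every integer $\hat{b}>nb$ such that $\hat{b}\equiv nb \pmod{b^2-1}$, there exists an asymmetric $(k+2)$-digit $(b,\hat{b})$-palintiple whose carries $(\hat{c}_{k+1},\hat{c}_k,\ldots,\hat{c}_0)$ are given by $(\hat{c}_{k+1},\hat{c}_k,\ldots,\hat{c}_0)=(d_k,d_{k-1},\ldots,d_0,0)$.
   Context: For integers $1<n<b$ and $k\ge 1$, write $(d_k,\ldots,d_0)_b=\sum_{j=0}^k d_jb^j$ with digits $0\le d_j<b$. It is called a $(k+1)$-digit $(n,b)$-palintiple (with multiplier $n$ and base $b$) if $d_k\neq 0$ (no leading zeros) and $(d_k,d_{k-1},\ldots,d_0)_b=n\,(d_0,d_1,\ldots,d_k)_b$. Its carries $c_k,\ldots,c_0$ are those of the base-$b$ single-digit multiplication: $c_0=0$ and $n d_{k-j}+c_j=d_j+b\,c_{j+1}$ for $0\le j\le k$ (so $c_{j+1}=\lfloor (n d_{k-j}+c_j)/b\rfloor$), with $c_{k+1}=0$. The palintiple is symmetric if $c_j=c_{k-j}$ for all $0\le j\le k$; shifted-symmetric if $c_j=c_{k-j+1}$ for all $0\le j\le k$; asymmetric if it is neither symmetric nor shifted-symmetric (for a palintiple with $K+1$ digits, replace $k$ by $K$ in these definitions). A 1089 $(n,b)$-palintiple is an $(n,b)$-palintiple whose Young graph $Y(n,b)$ is isomorphic to $Y(9,10)$; by a theorem of Kendrick this is equivalent to the condition that $n+1$ divides $b$,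 which may be taken as the definition here. *)

(* Defs.v *)
From mathcomp Require Import all_boot.

Set Implicit Arguments.
Unset Strict Implicit.
Unset Printing Implicit Defensive.

(* Digit tuples are little-endian: tnth d j is the coefficient of b ^ j.
   Hence (d_k, ..., d_0)_b has value  digits_val b d  and its reversal
   (d_0, ..., d_k)_b has value  digits_val b (rev d). *)
Definition digits_val (b : nat) (d : seq nat) : nat :=
  \sum_(j < size d) nth 0 d j * b ^ j.

Definition palintiple (n b k : nat) (d : k.+1.-tuple nat) : Prop :=
  [/\ 1 < n < b,
      0 < k,
      (forall j : 'I_k.+1, tnth d j < b),
      tnth d ord_max != 0
    & digits_val b d = n * digits_val b (rev d)].

(* The carries of the schoolbook multiplication of (d_0, ..., d_k)_b by n;
   the j-th digit of the multiplicand is d_(k-j).  For a palintiple they satisfy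
   n d_(k-j) + c_j = d_j + b c_(j+1) and c_(k+1) = 0: see carryE and
   carry_last. *)
Fixpoint carry (n b k : nat) (d : k.+1.-tuple nat) (j : nat) : nat :=
  if j is i.+1 then (n * nth 0 d (k - i) + carry n b d i) %/ b else 0.

Definition carries (n b k : nat) (d : k.+1.-tuple nat) : k.+1.-tuple nat :=
  [tuple carry n b d j | j < k.+1].

Definition symmetric_palintiple (n b k : nat) (d : k.+1.-tuple nat) : Prop :=
  palintiple n b d /\
  forall j, j <= k -> carry n b d j = carry n b d (k - j).

Definition shifted_symmetric_palintiple (n b k : nat) (d : k.+1.-tuple nat) :
    Prop :=
  palintiple n b d /\
  forall j, j <= k -> carry n b d j = carry n b d (k - j).+1.

Definition asymmetric_palintiple (n b k : nat) (d : k.+1.-tuple nat) : Prop :=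
  [/\ palintiple n b d,
      ~ symmetric_palintiple n b d
    & ~ shifted_symmetric_palintiple n b d].

(* The 1089 class, i.e. Young graph Y(n, b) isomorphic to Y(9, 10), through
   Kendrick's criterion n + 1 | b, taken as the definition. *)
Definition palintiple_1089 (n b k : nat) (d : k.+1.-tuple nat) : Prop :=
  palintiple n b d /\ n.+1 %| b.

Lemma base_digits_uniq (b m C : nat) (f g : nat -> nat) :
    (forall j, j < m -> f j < b) -> (forall j, j < m -> g j < b) ->
    \sum_(j < m) f j * b ^ j = \sum_(j < m) g j * b ^ j + b ^ m * C ->
  (forall j, j < m -> f j = g j) /\ C = 0.
Proof.
elim: m f g => [|m IHm] f g ltf ltg.
  by rewrite !big_ord0 mul1n add0n => <-; split.
have b_gt0: 0 < b by apply: leq_ltn_trans (ltf 0 _).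
have step (h : nat -> nat) : \sum_(j < m.+1) h j * b ^ j =
              b * (\sum_(j < m) h j.+1 * b ^ j) + h 0.
  rewrite big_ord_recl muln1 addnC big_distrr; congr (_ + _).
  by apply: eq_bigr => i _; rewrite /= expnS mulnCA.
rewrite !step addnAC expnS -mulnA -mulnDr => E.
have Ef0: f 0 = g 0.
  by move/(congr1 (modn^~ b)): E; rewrite ![b * _]mulnC !modnMDl !modn_small ?ltf ?ltg.
move: E; rewrite Ef0 => /addIn/eqP; rewrite eqn_pmul2l // => /eqP E.
have [||eq_fg C0] := IHm (f \o succn) (g \o succn) _ _ E; [by move=> j; apply: (ltf j.+1) | by move=> j; apply: (ltg j.+1) |].
by split=> // -[//|j]; apply: eq_fg.
Qed.

Lemma carry_digits (n b k : nat) (d : k.+1.-tuple nat) :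
    palintiple n b d ->
  (forall j, j < k.+1 -> nth 0 d j = (n * nth 0 d (k - j) + carry n b d j) %% b)
  /\ carry n b d k.+1 = 0.
Proof.
case=> /andP[n_gt1 ltnb] _ ltd _; rewrite /digits_val size_rev size_tuple => E.
have b_gt0: 0 < b by apply: leq_ltn_trans ltnb.
pose r j := (n * nth 0 d (k - j) + carry n b d j) %% b.
apply: (base_digits_uniq (b := b) (g := r)).
- by move=> j ltjk; have := ltd (Ordinal ltjk); rewrite (tnth_nth 0).
- by move=> j _; rewrite ltn_mod.
rewrite {}E; transitivity (n * \sum_(j < k.+1) nth 0 d (k - j) * b ^ j).
  congr (n * _); apply: eq_bigr => i _.
  by rewrite nth_rev ?size_tuple // subSS.
have H m : n * \sum_(j < m) nth 0 d (k - j) * b ^ j =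
            \sum_(j < m) r j * b ^ j + b ^ m * carry n b d m.
  elim: m => [|m IHm]; first by rewrite !big_ord0 !muln0.
  rewrite !big_ord_recr mulnDr {}IHm -!addnA; congr (_ + _).
  rewrite mulnA [b ^ m * _]mulnC -mulnDl addnC expnSr -mulnA.
  rewrite [r m * _]mulnC -mulnDr mulnC; congr (_ * _).
  rewrite [r m + _]addnC [b * _]mulnC; exact: divn_eq.
exact: H.
Qed.

Lemma carryE (n b k : nat) (d : k.+1.-tuple nat) (j : nat) :
    palintiple n b d -> j <= k ->
  n * nth 0 d (k - j) + carry n b d j = nth 0 d j + b * carry n b d j.+1.
Proof.
move=> /carry_digits[/(_ j) digE _] lejk.
by rewrite {}[in RHS]digE // [RHS]addnC [b * _]mulnC; apply: divn_eq.
Qed.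

Lemma carry_last (n b k : nat) (d : k.+1.-tuple nat) :
  palintiple n b d -> carry n b d k.+1 = 0.
Proof. by case/carry_digits. Qed.

(* Main.v *)
Require Import Defs.
From mathcomp Require Import all_boot.
From mathcomp Require Import zify ring.

Set Implicit Arguments.
Unset Strict Implicit.
Unset Printing Implicit Defensive.

(** Eliminating between the carry equations of positions [j] and [k - j] shows
    that the carries of a palintiple determine its digits. Apply this to the
    multiplier [b], the base [bh] and the prescribed carries [0, d_0, .., d_k]:
    the digit [D_j] of the wanted palintiple must satisfy
      [(b^2 - 1) D_j = bh (d_j + b d_(k+1-j)) - b d_(k-j) - d_(j-1)].
    Writing [bh = n b + t (b^2 - 1)], the right-hand side is divisible by
    [b^2 - 1] as soon as the carries of [d] satisfy [c_j = c_(k-j)]: the carry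
    equations of [d] then collapse the quotient to
      [D_j = t (d_j + b d_(k+1-j)) + d_(j-1) + b c_j].
    The last two terms equal [n d_(k+1-j) + c_(j-1)] with [c_(j-1) < n], so
    [D_j < t (b^2 - 1) + n b = bh]: these are genuine digits
    ([lifted_digit_lt]), and they have the prescribed carries
    ([lifted_digit_step]).

    The symmetry [c_j = c_(k-j)] is where [n + 1 | b] enters: modulo [n + 1]
    one has [n = -1] and [b = 0], so the carry equation at [j] reads
    [c_j = d_j + d_(k-j)], which is invariant under [j -> k - j]; and carries
    are smaller than [n] ([carry_sym_1089]).

    Finally, the carry out of the top position vanishes and [c_k = c_0 = 0], so
    [d_k = n d_0] with [d_k <> 0]. Symmetry of the new carries would force
    [d_k = 0], and shifted symmetry would force [d_0 = d_k = n d_0]. *)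

Lemma palintiple_nth_lt (n b k : nat) (d : k.+1.-tuple nat) (j : nat) :
  palintiple n b d -> nth 0 d j < b.
Proof.
case=> /andP[n_gt1 ltnb] _ ltd _ _.
have [ltjk|lekj] := ltnP j k.+1.
  by have := ltd (Ordinal ltjk); rewrite (tnth_nth 0).
by rewrite nth_default ?size_tuple //; lia.
Qed.

Lemma carry_lt (n b k : nat) (d : k.+1.-tuple nat) (j : nat) :
  palintiple n b d -> carry n b d j < n.
Proof.
move=> pal_d; have [/andP[n_gt1 ltnb] _ _ _ _] := pal_d.
elim: j => [|j IHj] /=; first by lia.
rewrite ltn_divLR; last by lia.
have := palintiple_nth_lt (k - j) pal_d; nia.
Qed.

(** Modulo [n + 1] the carries at [j] and [k - j] are both congruent to
    [d_j + d_(k-j)], and being smaller than [n] they are equal. *)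
Lemma carry_sym_1089 (n b k : nat) (d : k.+1.-tuple nat) (j : nat) :
  palintiple_1089 n b d -> j <= k -> carry n b d (k - j) = carry n b d j.
Proof.
case=> pal_d /dvdnP[q def_b] lejk.
have Ej := carryE pal_d lejk; have Ekj := carryE pal_d (leq_subr j k).
rewrite subKn // in Ekj.
have ltj := carry_lt j pal_d; have ltkj := carry_lt (k - j) pal_d.
move: Ej Ekj ltj ltkj; rewrite {2 5}def_b.
move: (carry n b d j) (carry n b d (k - j)) => c c'.
move: (carry n b d j.+1) (carry n b d (k - j).+1) => e e'.
move: (nth 0 d j) (nth 0 d (k - j)) => x y Ej Ekj ltc ltc'.
(* Difference of the two carry equations, with every multiple of [n + 1]
   collected and moved to the side where it is added. *)
have E : c + (y * n.+1 + q * e' * n.+1) = c' + (x * n.+1 + q * e * n.+1).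
  nia.
move/(congr1 (modn^~ n.+1)): E.
rewrite -!mulnDl !(addnC _ (_ * n.+1)) !modnMDl !modn_small //; lia.
Qed.

(** A converse to the carry equations: any sequence [a] that satisfies them
    and vanishes at both ends is the sequence of carries, by uniqueness of
    Euclidean division by the base; and the equations, weighted by the powers
    of the base, telescope to the palintiple identity. *)
Lemma palintiple_of_carries (n b k : nat) (d : k.+1.-tuple nat)
    (a : nat -> nat) :
    1 < n < b -> 0 < k -> (forall j, j <= k -> nth 0 d j < b) ->
    nth 0 d k != 0 -> a 0 = 0 -> a k.+1 = 0 ->
    (forall j, j <= k ->
       n * nth 0 d (k - j) + a j = nth 0 d j + b * a j.+1) ->
  palintiple n b d /\ (forall j, j <= k.+1 -> carry n b d j = a j).
Proof.
move=> ltnb k_gt0 ltd dk_neq0 a0 ak stepE; split.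
  split=> // [j||]; rewrite ?(tnth_nth 0) //.
    by apply: ltd; rewrite -ltnS.
  rewrite /digits_val size_rev size_tuple.
  have partialE m : m <= k.+1 ->
      n * (\sum_(j < m) nth 0 d (k - j) * b ^ j)
        = \sum_(j < m) nth 0 d j * b ^ j + b ^ m * a m.
    elim: m => [|m IHm] ltmk; first by rewrite !big_ord0 a0 !muln0.
    rewrite !big_ord_recr mulnDr IHm /=; last by lia.
    have := congr1 (muln (b ^ m)) (stepE m ltmk); rewrite expnS; nia.
  have := partialE k.+1 (leqnn _); rewrite ak muln0 addn0 => <-.
  congr (_ * _); apply: eq_bigr => i _.
  by rewrite nth_rev size_tuple // subSS.
elim=> [|j IHj] ltjk //=.
rewrite IHj; last by lia.
rewrite stepE // addnC mulnC divnMDl; last by lia.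
by rewrite divn_small ?addn0 // ltd.
Qed.

(** [D_j] with [bh = n b + t (b^2 - 1)]; [nth 0 (0 :: d) j] stands for
    [d_(j-1)], read as [0] at [j = 0]. *)
Definition lifted_digit (n b t k : nat) (d : k.+1.-tuple nat) (j : nat) : nat :=
  t * (nth 0 d j + b * nth 0 d (k.+1 - j)) + nth 0 (0 :: d) j
    + b * carry n b d j.

(** The carry equation of [d] at [j - 1], extended to [j = 0], where both
    sides vanish; it trades the last two terms of a lifted digit for
    [n d_(k+1-j) + c_(j-1)]. The truncated [0.-1 = 0] is harmless because
    [c_0 = 0]. *)
Lemma shifted_carryE (n b k : nat) (d : k.+1.-tuple nat) (j : nat) :
    palintiple n b d -> j <= k.+1 ->
  n * nth 0 d (k.+1 - j) + carry n b d j.-1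
    = nth 0 (0 :: d) j + b * carry n b d j.
Proof.
case: j => [|j] pal_d lejk; last by rewrite subSS carryE.
by rewrite subn0 nth_default ?size_tuple //= !muln0.
Qed.

Lemma lifted_digit_lt (n b t k : nat) (d : k.+1.-tuple nat) (j : nat) :
    palintiple n b d -> j <= k.+1 ->
  lifted_digit n b t d j < n * b + t * (b ^ 2 - 1).
Proof.
move=> pal_d lejk; rewrite /lifted_digit -addnA -shifted_carryE //.
have ltx := palintiple_nth_lt j pal_d.
have lty := palintiple_nth_lt (k.+1 - j) pal_d.
have ltc := carry_lt j.-1 pal_d.
move: (nth 0 d j) (nth 0 d (k.+1 - j)) (carry _ _ _ _) ltx lty ltc.
move=> x y c ltx lty ltc.
have le1 : x + b * y <= b ^ 2 - 1.
  have : b * y.+1 <= b * b by rewrite leq_mul2l lty orbT.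
  by rewrite mulnS -mulnn; lia.
have le2 : n * y + c < n * b.
  by have := leq_mul (leqnn n) lty; rewrite mulnS; lia.
by rewrite addnC -addSn leq_add // leq_mul2l le1 orbT.
Qed.

(** Substituting [n d_j + c_j] for the last two terms of the lifted digit at
    [k + 1 - j] makes both sides polynomially equal; that substitution relies
    on the symmetry of the carries of [d]. *)
Lemma lifted_digit_step (n b t k : nat) (d : k.+1.-tuple nat) (j : nat) :
    palintiple_1089 n b d -> j <= k.+1 ->
  b * lifted_digit n b t d (k.+1 - j) + nth 0 (0 :: d) j
    = lifted_digit n b t d j + (n * b + t * (b ^ 2 - 1)) * nth 0 d j.
Proof.
move=> d1089 lejk; have pal_d := d1089.1.
have [/andP[n_gt1 ltnb] _ _ _ _] := pal_d.
have Ekj := shifted_carryE pal_d (leq_subr j k.+1).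
rewrite subKn // in Ekj.
have symE : carry n b d (k.+1 - j).-1 = carry n b d j.
  have [lejk'|ltkj] := leqP j k.
    by rewrite subSn // carry_sym_1089.
  have -> : j = k.+1 by lia.
  by rewrite subnn carry_last.
rewrite {1}/lifted_digit -addnA -Ekj symE subKn // /lifted_digit.
have [s ->] : exists s, b = s.+1 by exists b.-1; lia.
have -> : s.+1 ^ 2 - 1 = s * s.+2 by lia.
ring.
Qed.

Lemma palintiple_1089_last (n b k : nat) (d : k.+1.-tuple nat) :
  palintiple_1089 n b d -> nth 0 d k = n * nth 0 d 0.
Proof.
move=> d1089; have pal_d := d1089.1.
have := carryE pal_d (leqnn k); rewrite carry_last // muln0 addn0 subnn => <-.
by rewrite -[X in carry n b d X]subn0 carry_sym_1089 // addn0.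
Qed.

Theorem theorem1 (n b k : nat) (d : k.+1.-tuple nat)
  (hd : palintiple_1089 n b d) (bh : nat) (hbh : n * b < bh)
  (hmod : bh = n * b %[mod b ^ 2 - 1]) :
  exists dh : k.+2.-tuple nat,
    asymmetric_palintiple b bh dh /\
    carries b bh dh = [tuple of 0 :: d].
Proof.
have [t def_bh] : exists t, bh = n * b + t * (b ^ 2 - 1).
  move/eqP: hmod; rewrite eqn_mod_dvd ?(ltnW hbh) // => /dvdnP[t def_t].
  by exists t; rewrite -def_t subnKC // ltnW.
have pal_d := hd.1; have [/andP[n_gt1 ltnb] _ _ dk_neq0 _] := pal_d.
rewrite (tnth_nth 0) /= in dk_neq0.
pose dh := [tuple lifted_digit n b t d j | j < k.+2].
have dhE j : j <= k.+1 -> nth 0 dh j = lifted_digit n b t d j.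
  by move=> lejk; rewrite -[j]/(val (Ordinal (lejk : j < k.+2))) -tnth_nth tnth_mktuple.
have [|||||||pal_dh carryhE] :=
    @palintiple_of_carries b bh k.+1 dh (nth 0 (0 :: d)).
- by apply/andP; split; nia.
- by [].
- by move=> j lejk; rewrite dhE // def_bh lifted_digit_lt.
- by rewrite dhE // /lifted_digit /= !addn_eq0 (negbTE dk_neq0) andbF.
- by [].
- by rewrite nth_default //= size_tuple.
- move=> j lejk; rewrite !dhE ?leq_subr // def_bh.
  exact: lifted_digit_step.
have lastE := palintiple_1089_last hd.
exists dh; split.
  split=> // [[_ /(_ 0 (leq0n _))]|[_ /(_ 1 (ltn0Sn _))]].
    by rewrite subn0 !carryhE //= => d0; rewrite -d0 in dk_neq0.
  rewrite subSS subn0 !carryhE //= => d0k.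
  by move: dk_neq0 lastE; rewrite -d0k; nia.
apply: eq_from_tnth => j; rewrite tnth_mktuple (tnth_nth 0) carryhE //.
by rewrite ltnW // ltn_ord.
Qed.
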